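(* Let $(M,\nabla,\boldsymbol{\nabla},\ast,\star,e,E)$ be a bi-flat $F$-manifold. Then $(\nabla,\ast,E)$ is a Saito structure on $M$ and $$\boldsymbol{\nabla}_x\,y=\nabla_x\,y-\nabla_{x\star y}\,E\qquad(x,y\in\mathcal{T}_M).$$
   Context: Manifolds are complex manifolds, $\mathcal{T}_M$ is the sheaf of holomorphic vector fields, and a multiplication on $TM$ is an $\mathcal{O}_M$-bilinear map $\mathcal{T}_M\times\mathcal{T}_M\to\mathcal{T}_M$. A bi-flat $F$-manifold $(M,\nabla,\boldsymbol{\nabla},\ast,\star,e,E)$ consists of a manifold $M$, torsion-free flat connections $\nabla,\boldsymbol{\nabla}$ on $TM$, and associative commutative multiplications $\ast$ and $\star$ on $TM$ with units $e$ and $E$ respectively, such that for all $x,y,z\in\mathcal{T}_M$: - $\nabla_x(y\ast z)-y\ast\nabla_xz-\nabla_y(x\ast z)+x\ast\nabla_yz=[x,y]\ast z$; - $[E,x\ast y]-[E,x]\ast y-x\ast[E,y]=x\ast y$; - $\nabla e=0$; - $\boldsymbol{\nabla}_x(y\star z)-y\star\boldsymbol{\nabla}_xz-\boldsymbol{\nabla}_y(x\star z)+x\star\boldsymbol{\nabla}_yz=[x,y]\star z$; - $\boldsymbol{\nabla}E=0$; - the endomorphism $\mathcal{U}(x)=E\ast x$ of $\mathcal{T}_M$ is an isomorphism and $E\ast(x\star y)=x\ast y$; - $\nabla$ and $\boldsymbol{\nabla}$ are almost hydrodynamically equivalent: $\boldsymbol{\nabla}_x(y\ast z)-\boldsymbol{\nabla}_y(x\ast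 z)=\nabla_x(y\ast z)-\nabla_y(x\ast z)$. A Saito structure $(\nabla,\ast,E)$ on $M$ consists of a torsion-free flat connection $\nabla$ on $TM$, an associative commutative multiplication $\ast$ with unit $e$, and a vector field $E$ satisfying the first three conditions above and in addition $\nabla_x\nabla_yE-\nabla_{\nabla_xy}E=0$ for all $x,y\in\mathcal{T}_M$. *)

(* Defs.v *)
From HB Require Import structures.
From mathcomp Require Import all_boot all_order all_algebra.
From mathcomp Require Import all_classical all_reals all_analysis.
From mathcomp Require Import complex ring.
Set Implicit Arguments.
Unset Strict Implicit.
Unset Printing Implicit Defensive.
Import Order.TTheory GRing.Theory Num.Theory.
Import numFieldNormedType.Exports.
Local Open Scope classical_set_scope.
Local Open Scope ring_scope.

(* Typing [R[i]] as a [numFieldType] gives it the canonical topology and norm,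
   so that [differentiable] below means complex differentiable. *)
Definition cplx (R : realType) : numFieldType := R[i].

Lemma near_eq_differentiable (K : numFieldType) (V W : normedModType K)
    (f g : V -> W) (x : V) :
  (\forall z \near x, f z = g z) -> differentiable f x -> differentiable g x.
Proof.
move=> fg /diffP[dc df]; apply/diffP.
apply: (@getPex _ (fun dg : {linear V -> W} => continuous dg /\
  forall y, g y = g (lim (nbhs x)) + dg (y - lim (nbhs x))
                  +o_(y \near x) (y - lim (nbhs x)))).
exists ('d f x); split=> //.
move: df; rewrite lim_id // => df; have fx := nbhs_singleton fg.
set h := fun y => f x + 'd f x (y - x).
have {df} /eqaddoP df : f = h +o_ (nbhs x) (fun y => y - x).
  by apply: eqaddoE; apply/funext => y; exact: df.
have /eqaddoE dg : g = h +o_ (nbhs x) (fun y => y - x).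
  apply/eqaddoP => e e0; have := df e e0; apply: filterS2 fg => y fgy.
  by rewrite !fctE fgy.
by apply: eqaddoEx => y; rewrite -fx {1}dg.
Qed.

(* A complex manifold of dimension [n], presented by a holomorphic atlas.
   [coord i] and [param i] are inverse homeomorphisms between the open sets
   [dom i] and [coord i @` dom i]; their values elsewhere are irrelevant. *)
Record complexManifold (R : realType) (n : nat) := ComplexManifold {
  carrier :> topologicalType;
  chart : Type;
  dom : chart -> set carrier;
  coord : chart -> carrier -> 'rV[cplx R]_n;
  param : chart -> 'rV[cplx R]_n -> carrier;
  manifold_hausdorff : hausdorff_space carrier;
  manifold_second_countable : @second_countable carrier;
  dom_open : forall i, open (dom i);
  dom_cover : forall p, exists i, dom i p;
  coord_open : forall i, open (coord i @` dom i);
  coordK : forall i p, dom i p -> param i (coord i p) = p;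
  coord_continuous : forall i p, dom i p -> {for p, continuous (coord i)};
  param_continuous : forall i p, dom i p ->
    {for coord i p, continuous (param i)};
  transition_holomorphic : forall i j p, dom i p -> dom j p ->
    differentiable (coord j \o param i) (coord i p) }.

Record opens (T : topologicalType) := Opens {
  oset :> set T;
  osetP : open oset }.

Definition opensT (T : topologicalType) : opens T := Opens (@openT T).

Section ComplexManifold.
Variables (R : realType) (n : nat) (M : complexManifold R n).
Local Notation C := (cplx R).

Definition holomorphic (U : set M) (f : M -> C) : Prop :=
  forall i p, U p -> dom i p -> differentiable (f \o param i) (coord i p).

Record ofun (U : set M) := Ofun {
  ofun_val :> M -> C;
  ofunP : holomorphic U ofun_val }.

Definition holomorphic_near (p : M) (f : M -> C) : Prop :=
  exists2 V : set M, open_nbhs p V & holomorphic V f.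

(* A tangent vector at [p] is a [C]-linear derivation of the stalk at [p] of
   the sheaf of holomorphic functions, seen as a function of representatives
   of germs; it is given the value 0 on functions that represent no germ. *)
Record tangent_vector (p : M) (v : (M -> C) -> C) : Prop := TangentVector {
  tangent_germ : forall f g, holomorphic_near p f -> holomorphic_near p g ->
    (\forall q \near p, f q = g q) -> v f = v g;
  tangentD : forall f g, holomorphic_near p f -> holomorphic_near p g ->
    v (fun q => f q + g q) = v f + v g;
  tangentZ : forall (a : C) f, holomorphic_near p f ->
    v (fun q => a * f q) = a * v f;
  tangentM : forall f g, holomorphic_near p f -> holomorphic_near p g ->
    v (fun q => f q * g q) = v f * g p + f p * v g;
  tangent_out : forall f, ~ holomorphic_near p f -> v f = 0 }.

(* [X p f] is the derivative of [f] along the tangent vector at [p].  Setting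
   it to 0 for [p] outside [U] makes the representation unique. *)
Record is_vfield (U : set M) (X : M -> (M -> C) -> C) : Prop := IsVfield {
  vfield_tangent : forall p, U p -> tangent_vector p (X p);
  vfield_holomorphic : forall (V : set M) f, open V -> V `<=` U ->
    holomorphic V f -> holomorphic V (fun p => X p f);
  vfield_out : forall p f, ~ U p -> X p f = 0 }.

Record vfield (U : set M) := Vfield {
  vfield_val :> M -> (M -> C) -> C;
  vfieldP : is_vfield U vfield_val }.

HB.instance Definition _ (U : set M) := gen_eqMixin (vfield U).
HB.instance Definition _ (U : set M) := gen_choiceMixin (vfield U).

Lemma vfield_eq (U : set M) (X Y : vfield U) :
  (forall p f, X p f = Y p f) -> X = Y.
Proof.
case: X Y => [X XP] [Y YP] /= XY.
have e : X = Y by apply: funext => p; apply: funext => f.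
by case: _ / e YP => YP; congr Vfield; exact: Prop_irrelevance.
Qed.

Lemma holomorphicS (U V : set M) f :
  V `<=` U -> holomorphic U f -> holomorphic V f.
Proof. by move=> VU fU i p /VU; exact: fU. Qed.

Lemma holomorphic_cst (U : set M) (a : C) : holomorphic U (fun=> a).
Proof. by move=> i p _ _; exact: differentiable_cst. Qed.

Lemma holomorphicD (U : set M) f g : holomorphic U f -> holomorphic U g ->
  holomorphic U (fun p => f p + g p).
Proof.
by move=> fU gU i p Up ip; exact: differentiableD (fU _ _ Up ip) (gU _ _ Up ip).
Qed.

Lemma holomorphicN (U : set M) f : holomorphic U f ->
  holomorphic U (fun p => - f p).
Proof. by move=> fU i p Up ip; exact: differentiableN (fU _ _ Up ip). Qed.

Lemma holomorphicM (U : set M) f g : holomorphic U f -> holomorphic U g ->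
  holomorphic U (fun p => f p * g p).
Proof.
by move=> fU gU i p Up ip; exact: differentiableM (fU _ _ Up ip) (gU _ _ Up ip).
Qed.

Lemma holomorphic_eq (V : set M) f g : open V -> (forall p, V p -> f p = g p) ->
  holomorphic V f -> holomorphic V g.
Proof.
move=> oV fg fV i p Vp ip; move: (fV i p Vp ip); apply: near_eq_differentiable.
have pV : nbhs (param i (coord i p)) V.
  by rewrite coordK //; exact: open_nbhs_nbhs.
have pV' : nbhs (coord i p) (param i @^-1` V) := param_continuous ip pV.
by apply: filterS pV' => z; exact: fg.
Qed.

Lemma holomorphic_nearS (U : set M) f p :
  open U -> U p -> holomorphic U f -> holomorphic_near p f.
Proof. by move=> oU Up fU; exists U. Qed.

Lemma holomorphic_near_in (U : set M) f p : open U -> U p ->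
  holomorphic_near p f ->
  exists V : set M, [/\ open V, V p, V `<=` U & holomorphic V f].
Proof.
move=> oU Up [V [oV Vp] fV]; exists (V `&` U); split => //.
- exact: openI.
- by apply: holomorphicS fV.
Qed.

Lemma near_holomorphic_near f p : holomorphic_near p f ->
  \forall q \near p, holomorphic_near q f.
Proof.
move=> [V [oV Vp] fV]; have : nbhs p V by apply: open_nbhs_nbhs.
by apply: filterS => q Vq; exists V.
Qed.

Lemma holomorphic_near_cst p (a : C) : holomorphic_near p (fun=> a).
Proof. by exists setT; [split=> //; exact: openT|exact: holomorphic_cst]. Qed.

Lemma holomorphic_nearD p f g : holomorphic_near p f -> holomorphic_near p g ->
  holomorphic_near p (fun q => f q + g q).
Proof.
move=> [V [oV Vp] fV] [W [oW Wp] gW]; exists (V `&` W).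
  by split; [exact: openI|].
by apply: holomorphicD; [apply: holomorphicS fV|apply: holomorphicS gW].
Qed.

Lemma holomorphic_nearM p f g : holomorphic_near p f -> holomorphic_near p g ->
  holomorphic_near p (fun q => f q * g q).
Proof.
move=> [V [oV Vp] fV] [W [oW Wp] gW]; exists (V `&` W).
  by split; [exact: openI|].
by apply: holomorphicM; [apply: holomorphicS fV|apply: holomorphicS gW].
Qed.

Fact vfield0_subproof (U : set M) : is_vfield U (fun _ _ => 0).
Proof.
split=> // [p Up|V f oV VU fV]; last exact: holomorphic_cst.
by split=> // *; rewrite ?(addr0, mulr0, mul0r).
Qed.
Definition vfield0 (U : set M) := Vfield (vfield0_subproof U).

Fact vfield_add_subproof (U : set M) (X Y : vfield U) :
  is_vfield U (fun p f => X p f + Y p f).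
Proof.
have XP := vfieldP X; have YP := vfieldP Y; split=> [p Up|V f oV VU fV|p f Up].
- have tX := vfield_tangent XP Up; have tY := vfield_tangent YP Up.
  split=> [f g fp gp fg|f g fp gp|a f fp|f g fp gp|f fp].
  + by rewrite (tangent_germ tX fp gp fg) (tangent_germ tY fp gp fg).
  + by rewrite (tangentD tX) // (tangentD tY) // addrACA.
  + by rewrite (tangentZ tX) // (tangentZ tY) // mulrDr.
  + by rewrite (tangentM tX) // (tangentM tY) // mulrDl mulrDr addrACA.
  + by rewrite (tangent_out tX) // (tangent_out tY) // addr0.
- by apply: holomorphicD; [apply: (vfield_holomorphic XP)|
                           apply: (vfield_holomorphic YP)].
- by rewrite (vfield_out XP) // (vfield_out YP) // addr0.
Qed.
Definition vfield_add (U : set M) (X Y : vfield U) :=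
  Vfield (vfield_add_subproof X Y).

Fact vscale_subproof (U : set M) (a : ofun U) (X : vfield U) :
  is_vfield U (fun p f => a p * X p f).
Proof.
have XP := vfieldP X; split=> [p Up|V f oV VU fV|p f Up].
- have tX := vfield_tangent XP Up.
  split=> [f g fp gp fg|f g fp gp|b f fp|f g fp gp|f fp].
  + by rewrite (tangent_germ tX fp gp fg).
  + by rewrite (tangentD tX) // mulrDr.
  + by rewrite (tangentZ tX) // mulrCA.
  + by rewrite (tangentM tX) // mulrDr mulrA; congr (_ + _); rewrite mulrCA.
  + by rewrite (tangent_out tX) // mulr0.
- apply: holomorphicM; last exact: (vfield_holomorphic XP).
  exact: holomorphicS VU (ofunP a).
- by rewrite (vfield_out XP) // mulr0.
Qed.
Definition vscale (U : set M) (a : ofun U) (X : vfield U) :=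
  Vfield (vscale_subproof a X).

Definition vfield_opp (U : set M) (X : vfield U) :=
  vscale (Ofun (@holomorphic_cst U (-1))) X.

Fact vfield_addA (U : set M) : associative (@vfield_add U).
Proof. by move=> X Y Z; apply: vfield_eq => p f /=; rewrite addrA. Qed.
Fact vfield_addC (U : set M) : commutative (@vfield_add U).
Proof. by move=> X Y; apply: vfield_eq => p f /=; rewrite addrC. Qed.
Fact vfield_add0 (U : set M) : left_id (vfield0 U) (@vfield_add U).
Proof. by move=> X; apply: vfield_eq => p f /=; rewrite add0r. Qed.
Fact vfield_addN (U : set M) :
  left_inverse (vfield0 U) (@vfield_opp U) (@vfield_add U).
Proof. by move=> X; apply: vfield_eq => p f /=; rewrite mulN1r addNr. Qed.

HB.instance Definition _ (U : set M) := GRing.isZmodule.Build (vfield U)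
  (@vfield_addA U) (@vfield_addC U) (@vfield_add0 U) (@vfield_addN U).

Lemma vfieldDE (U : set M) (X Y : vfield U) p f : (X + Y) p f = X p f + Y p f.
Proof. by []. Qed.

Lemma vfieldNE (U : set M) (X : vfield U) p f : (- X) p f = - X p f.
Proof. exact: mulN1r. Qed.

Lemma vfieldBE (U : set M) (X Y : vfield U) p f : (X - Y) p f = X p f - Y p f.
Proof. by rewrite vfieldDE vfieldNE. Qed.

Fact vderiv_subproof (U : opens M) (X : vfield U) (a : ofun U) :
  holomorphic U (fun p => X p a).
Proof. exact: (vfield_holomorphic (vfieldP X)) (osetP U) _ (ofunP a). Qed.
Definition vderiv (U : opens M) (X : vfield U) (a : ofun U) : ofun U :=
  Ofun (vderiv_subproof X a).

Lemma vderiv_near (U : opens M) (X : vfield U) f p : oset U p ->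
  holomorphic_near p f -> holomorphic_near p (fun q => X q f).
Proof.
move=> Up /(holomorphic_near_in (osetP U) Up)[V [oV Vp VU fV]].
by exists V => //; exact: (vfield_holomorphic (vfieldP X)).
Qed.

Definition bracket_fun (U : opens M) (X Y : vfield U) (p : M) (f : M -> C) :=
  if `[< oset U p /\ holomorphic_near p f >]
  then X p (fun q => Y q f) - Y p (fun q => X q f) else 0.

Lemma near_opens (U : opens M) p : oset U p -> \forall q \near p, oset U q.
Proof. by move=> Up; apply: open_nbhs_nbhs; split=> //; exact: osetP. Qed.

Fact bracket_subproof (U : opens M) (X Y : vfield U) :
  is_vfield U (bracket_fun X Y).
Proof.
have T (Z : vfield U) p : oset U p -> tangent_vector p (Z p).
  exact: (vfield_tangent (vfieldP Z)).
have E p f : oset U p -> holomorphic_near p f ->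
    bracket_fun X Y p f = X p (fun q => Y q f) - Y p (fun q => X q f).
  by move=> Up fp; rewrite /bracket_fun asboolT.
have TN (Z Z' : vfield U) p f h : oset U p -> holomorphic_near p f ->
    holomorphic_near p h ->
    (forall q, oset U q -> holomorphic_near q f -> Z' q f = h q) ->
    Z p (fun q => Z' q f) = Z p h.
  move=> Up fp hp Z'h; apply: (tangent_germ (T Z p Up)) => //.
    exact: vderiv_near.
  by apply: filterS2 (near_opens Up) (near_holomorphic_near fp)
    => q; exact: Z'h.
have TD (Z Z' : vfield U) p f g : oset U p -> holomorphic_near p f ->
    holomorphic_near p g -> Z p (fun q => Z' q (fun r => f r + g r)) =
      Z p (fun q => Z' q f) + Z p (fun q => Z' q g).
  move=> Up fp gp; rewrite -(tangentD (T Z p Up)); try exact: vderiv_near.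
  apply: (tangent_germ (T Z p Up)).
  - by apply: vderiv_near => //; exact: holomorphic_nearD.
  - by apply: holomorphic_nearD; exact: vderiv_near.
  - apply: filterS3 (near_opens Up) (near_holomorphic_near fp)
      (near_holomorphic_near gp) => q Uq fq gq.
    exact: (tangentD (T Z' q Uq)).
have TZ (Z Z' : vfield U) p (a : C) f : oset U p -> holomorphic_near p f ->
    Z p (fun q => Z' q (fun r => a * f r)) = a * Z p (fun q => Z' q f).
  move=> Up fp; rewrite -(tangentZ (T Z p Up)); last exact: vderiv_near.
  have ap := holomorphic_near_cst p a.
  apply: (tangent_germ (T Z p Up)).
  - by apply: vderiv_near => //; exact: holomorphic_nearM.
  - by apply: holomorphic_nearM => //; exact: vderiv_near.
  - apply: filterS2 (near_opens Up) (near_holomorphic_near fp) => q Uq fq.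
    exact: (tangentZ (T Z' q Uq)).
have TM (Z Z' : vfield U) p f g : oset U p -> holomorphic_near p f ->
    holomorphic_near p g -> Z p (fun q => Z' q (fun r => f r * g r)) =
      Z p (fun q => Z' q f) * g p + Z' p f * Z p g +
      (Z p f * Z' p g + f p * Z p (fun q => Z' q g)).
  move=> Up fp gp.
  have Zf := vderiv_near Z' Up fp; have Zg := vderiv_near Z' Up gp.
  rewrite -(tangentM (T Z p Up) Zf gp) -(tangentM (T Z p Up) fp Zg).
  rewrite -(tangentD (T Z p Up)); try exact: holomorphic_nearM.
  apply: (tangent_germ (T Z p Up)).
  - by apply: vderiv_near => //; exact: holomorphic_nearM.
  - by apply: holomorphic_nearD; exact: holomorphic_nearM.
  - apply: filterS3 (near_opens Up) (near_holomorphic_near fp)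
      (near_holomorphic_near gp) => q Uq fq gq.
    exact: (tangentM (T Z' q Uq)).
have TG (Z Z' : vfield U) p f g : oset U p -> holomorphic_near p f ->
    holomorphic_near p g -> (\forall q \near p, f q = g q) ->
    Z p (fun q => Z' q f) = Z p (fun q => Z' q g).
  move=> Up fp gp fg; apply: (tangent_germ (T Z p Up)).
  - exact: vderiv_near.
  - exact: vderiv_near.
  - have UF : \forall q \near p, oset U q /\ holomorphic_near q f.
      by apply: filterS2 (near_opens Up) (near_holomorphic_near fp).
    apply: filterS3 UF (near_holomorphic_near gp) (near_join fg)
      => q [Uq fq] gq fgq.
    exact: (tangent_germ (T Z' q Uq)).
split=> [p Up|V f oV VU fV|p f Up].
- split=> [f g fp gp fg|f g fp gp|a f fp|f g fp gp|f fp].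
  + by rewrite !E // (TG X Y p f g) // (TG Y X p f g).
  + by rewrite !E ?TD //; [rewrite opprD addrACA|exact: holomorphic_nearD].
  + rewrite !E ?TZ //; first by rewrite mulrBr.
    by apply: holomorphic_nearM => //; exact: holomorphic_near_cst.
  + rewrite !E ?TM //; last exact: holomorphic_nearM.
    ring.
  + by rewrite /bracket_fun asboolF // => -[].
- have XY (Z Z' : vfield U) : holomorphic V (fun p => Z p (fun q => Z' q f)).
    apply: (vfield_holomorphic (vfieldP Z)) => //.
    exact: (vfield_holomorphic (vfieldP Z')).
  apply: holomorphic_eq (holomorphicD (XY X Y) (holomorphicN (XY Y X))) => //.
  by move=> p Vp; rewrite E //; [exact: VU|exact: holomorphic_nearS fV].
- by rewrite /bracket_fun asboolF // => -[].
Qed.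
Definition bracket (U : opens M) (X Y : vfield U) : vfield U :=
  Vfield (bracket_subproof X Y).

Definition vrestrict_fun (V : set M) (X : M -> (M -> C) -> C)
    (p : M) (f : M -> C) : C :=
  if `[< V p >] then X p f else 0.

Fact vrestrict_subproof (U V : set M) (VU : V `<=` U) (X : vfield U) :
  is_vfield V (vrestrict_fun V X).
Proof.
have E p : V p -> vrestrict_fun V X p = X p.
  by move=> Vp; apply/funext => f; rewrite /vrestrict_fun asboolT.
split=> [p Vp|W f oW WV fW|p f Vp].
- by rewrite E //; exact: (vfield_tangent (vfieldP X)) (VU _ Vp).
- have WU := subset_trans WV VU.
  apply: holomorphic_eq (vfield_holomorphic (vfieldP X) oW WU fW) => //.
  by move=> p /WV Vp; rewrite E.
- by rewrite /vrestrict_fun asboolF.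
Qed.
Definition vrestrict (U V : set M) (VU : V `<=` U) (X : vfield U) : vfield V :=
  Vfield (vrestrict_subproof VU X).

Definition global_on (U : opens M) (X : vfield (opensT M)) : vfield U :=
  vrestrict (@subsetT M U) X.

Record multiplication := Multiplication {
  mult :> forall U : opens M, vfield U -> vfield U -> vfield U;
  mult_restrict : forall (U V : opens M) (VU : V `<=` U) (x y : vfield U),
    vrestrict VU (mult x y) = mult (vrestrict VU x) (vrestrict VU y);
  multDl : forall (U : opens M) (x x' y : vfield U),
    mult (x + x') y = mult x y + mult x' y;
  multDr : forall (U : opens M) (x y y' : vfield U),
    mult x (y + y') = mult x y + mult x y';
  multZl : forall (U : opens M) (a : ofun U) (x y : vfield U),
    mult (vscale a x) y = vscale a (mult x y);
  multZr : forall (U : opens M) (a : ofun U) (x y : vfield U),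
    mult x (vscale a y) = vscale a (mult x y) }.

(* A holomorphic connection on the tangent bundle; [nabla x y] is the covariant
   derivative of [y] along [x]. *)
Record connection := Connection {
  nabla :> forall U : opens M, vfield U -> vfield U -> vfield U;
  nabla_restrict : forall (U V : opens M) (VU : V `<=` U) (x y : vfield U),
    vrestrict VU (nabla x y) = nabla (vrestrict VU x) (vrestrict VU y);
  nablaDl : forall (U : opens M) (x x' y : vfield U),
    nabla (x + x') y = nabla x y + nabla x' y;
  nablaZl : forall (U : opens M) (a : ofun U) (x y : vfield U),
    nabla (vscale a x) y = vscale a (nabla x y);
  nablaDr : forall (U : opens M) (x y y' : vfield U),
    nabla x (y + y') = nabla x y + nabla x y';
  nabla_leibniz : forall (U : opens M) (a : ofun U) (x y : vfield U),
    nabla x (vscale a y) = vscale (vderiv x a) y + vscale a (nabla x y) }.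

Definition mult_comm (m : multiplication) : Prop :=
  forall (U : opens M) (x y : vfield U), m U x y = m U y x.

Definition mult_assoc (m : multiplication) : Prop :=
  forall (U : opens M) (x y z : vfield U), m U x (m U y z) = m U (m U x y) z.

Definition mult_unit (m : multiplication) (e : vfield (opensT M)) : Prop :=
  forall (U : opens M) (x : vfield U), m U (global_on U e) x = x.

Definition torsion_free (D : connection) : Prop :=
  forall (U : opens M) (x y : vfield U), D U x y - D U y x = bracket x y.

Definition flat (D : connection) : Prop :=
  forall (U : opens M) (x y z : vfield U),
    D U x (D U y z) - D U y (D U x z) - D U (bracket x y) z = 0.

Definition parallel (D : connection) (e : vfield (opensT M)) : Prop :=
  forall (U : opens M) (x : vfield U), D U x (global_on U e) = 0.

Definition compatible (D : connection) (m : multiplication) : Prop :=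
  forall (U : opens M) (x y z : vfield U),
    D U x (m U y z) - m U y (D U x z) - D U y (m U x z) + m U x (D U y z) =
    m U (bracket x y) z.

Definition euler_field (m : multiplication) (E : vfield (opensT M)) : Prop :=
  forall (U : opens M) (x y : vfield U), let EU := global_on U E in
    bracket EU (m U x y) - m U (bracket EU x) y - m U x (bracket EU y) =
    m U x y.

Definition almost_hydrodynamically_equivalent (D D' : connection)
    (m : multiplication) : Prop :=
  forall (U : opens M) (x y z : vfield U),
    D' U x (m U y z) - D' U y (m U x z) = D U x (m U y z) - D U y (m U x z).

Record biflat_F_manifold (D D' : connection) (ast star : multiplication)
    (e E : vfield (opensT M)) : Prop := BiflatFManifold {
  biflat_torsion : torsion_free D;
  biflat_flat : flat D;
  biflat_torsion' : torsion_free D';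
  biflat_flat' : flat D';
  biflat_astC : mult_comm ast;
  biflat_astA : mult_assoc ast;
  biflat_ast1 : mult_unit ast e;
  biflat_starC : mult_comm star;
  biflat_starA : mult_assoc star;
  biflat_star1 : mult_unit star E;
  biflat_compatible : compatible D ast;
  biflat_euler : euler_field ast E;
  biflat_unit_parallel : parallel D e;
  biflat_compatible' : compatible D' star;
  biflat_unit_parallel' : parallel D' E;
  biflat_mulE_iso : forall U : opens M, bijective (ast U (global_on U E));
  biflat_mulE_star : forall (U : opens M) (x y : vfield U),
    ast U (global_on U E) (star U x y) = ast U x y;
  biflat_hydrodynamic : almost_hydrodynamically_equivalent D D' ast }.

(* [e] is an explicit argument although it is determined by [ast]. *)
Record saito_structure (D : connection) (ast : multiplication)
    (e E : vfield (opensT M)) : Prop := SaitoStructure {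
  saito_torsion : torsion_free D;
  saito_flat : flat D;
  saito_astC : mult_comm ast;
  saito_astA : mult_assoc ast;
  saito_ast1 : mult_unit ast e;
  saito_compatible : compatible D ast;
  saito_euler : euler_field ast E;
  saito_unit_parallel : parallel D e;
  saito_nabla2E : forall (U : opens M) (x y : vfield U),
    D U x (D U y (global_on U E)) - D U (D U x y) (global_on U E) = 0 }.

End ComplexManifold.

(* Main.v *)
Require Import Defs.
From mathcomp Require Import all_boot all_order all_algebra.
From mathcomp Require Import all_classical all_reals all_analysis.
From mathcomp Require Import ring.
Import GRing.Theory.
Local Open Scope ring_scope.

(** Write [N w] for the derivative of [E] along [w], and [H x w] for the second
covariant derivative of [E], both with respect to [D].

The formula for [D'] is almost hydrodynamic equivalence read on the difference
[A x y = D' x y - D x y]: it says that [A x (y * z)] is symmetric in [x] and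
[y], so that, [e] being the unit, [A x y] depends on [x * y] only
([nabla_diff_mult]).  As [x * y = (star x y) * E], the field [A x y] equals
[A (star x y) E], which is [- N (star x y)] because [E] is parallel for [D'].

The vanishing of [H] comes from the flatness of [D'].  Substituting the formula
for [D'], the curvature of [D'] differs from that of [D] by the antisymmetric
part in [x, y] of [H x (star y z)] plus [N] of a field that the compatibility of
[D'] with [star] identifies as zero.  Hence [H x (star y z)] is symmetric in [x]
and [y] ([hessian_star_swap]).  The Euler condition forces [N e = e], and [e]
is parallel, so [H x e = 0] ([hessian_unit]).  Since [star y] is invertible when
[y = e], every field is [star e z] for some [z], and
[H x (star e z) = H e (star x z) = H (star x z) e = 0], where the last exchange
is the symmetry of the Hessian of a flat torsion-free connection. *)

Section BiFlat.
Set Implicit Arguments.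
Unset Strict Implicit.
Variables (R : realType) (n : nat) (M : complexManifold R n).
Implicit Types (D : connection M) (m : multiplication M) (U : opens M).

Lemma nablaBl D U (x x' y : vfield U) : D U (x - x') y = D U x y - D U x' y.
Proof. by apply: (addIr (D U x' y)); rewrite subrK -nablaDl subrK. Qed.

Lemma nablaBr D U (x y y' : vfield U) : D U x (y - y') = D U x y - D U x y'.
Proof. by apply: (addIr (D U x y')); rewrite subrK -nablaDr subrK. Qed.

Lemma multBr m U (x y y' : vfield U) : m U x (y - y') = m U x y - m U x y'.
Proof. by apply: (addIr (m U x y')); rewrite subrK -multDr subrK. Qed.

Definition hessian D (E : vfield (opensT M)) U (x y : vfield U) : vfield U :=
  D U x (D U y (global_on U E)) - D U (D U x y) (global_on U E).
Arguments hessian D E {U} x y.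

(** The antisymmetric part of the Hessian of a field is the curvature applied
to that field, once the torsion-free condition turns [D x y - D y x] into the
bracket. *)
Lemma hessianC D E U (x y : vfield U) : torsion_free D -> flat D ->
  hessian D E x y = hessian D E y x.
Proof.
move=> torsD flatD; apply/eqP; rewrite -subr_eq0 /hessian.
have := flatD U x y (global_on U E); rewrite -torsD nablaBl => <-.
by apply/eqP/vfield_eq => p f; rewrite !vfieldBE; ring.
Qed.

(** The Euler condition at the pair [e, e] says that the bracket of [E] and
[e] is [- e]. *)
Lemma nabla_unit_euler D m (e E : vfield (opensT M)) U :
  torsion_free D -> mult_comm m -> mult_unit m e -> euler_field m E ->
  parallel D e -> D U (global_on U e) (global_on U E) = global_on U e.
Proof.
move=> torsD mC m1 eulerE De0.
have := eulerE U (global_on U e) (global_on U e).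
rewrite /= (mC _ _ (global_on U e)) !m1 subrr sub0r -torsD De0.
by rewrite sub0r opprK.
Qed.

Lemma hessian_unit D m (e E : vfield (opensT M)) U (x : vfield U) :
  torsion_free D -> mult_comm m -> mult_unit m e -> euler_field m E ->
  parallel D e -> hessian D E x (global_on U e) = 0.
Proof.
move=> torsD mC m1 eulerE De0; rewrite /hessian.
rewrite (nabla_unit_euler U torsD mC m1 eulerE De0) De0.
(* [D] along the zero field, written as [0 - 0] to use additivity *)
by rewrite -[X in D U X](subrr 0) nablaBl !subrr.
Qed.

Lemma nabla_diff_mult D D' m (e : vfield (opensT M)) U
    (x y : vfield U) :
  mult_comm m -> mult_unit m e -> almost_hydrodynamically_equivalent D D' m ->
  D' U x y - D U x y =
  D' U (global_on U e) (m U x y) - D U (global_on U e) (m U x y).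
Proof.
move=> mC m1 hydro; have := hydro U x (global_on U e) y; rewrite !m1 => /eqP.
by rewrite subr_eq -addrA addrC -subr_eq [X in _ == X]addrC => /eqP.
Qed.

Section Structure.
Variables (D D' : connection M) (ast star : multiplication M).
Variables (e E : vfield (opensT M)).
Hypothesis biflat : biflat_F_manifold D D' ast star e E.

Lemma biflat_nablaE U (x y : vfield U) :
  D' U x y = D U x y - D U (star U x y) (global_on U E).
Proof.
have astC := biflat_astC biflat; have ast1 := biflat_ast1 biflat.
have hydro := biflat_hydrodynamic biflat.
apply/eqP; rewrite addrC -subr_eq; apply/eqP.
rewrite (nabla_diff_mult x y astC ast1 hydro) -(biflat_mulE_star biflat) astC.
rewrite -(nabla_diff_mult _ _ astC ast1 hydro).
by rewrite (biflat_unit_parallel' biflat) sub0r.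
Qed.

(** The field [P x y] below collects all the terms of [D' x (D' y z)] on which
the derivative of [E] acts linearly; the compatibility of [D'] with [star] is
the statement that its antisymmetric part is [star (bracket x y) z], which
cancels the contribution of [D' (bracket x y) z] to the curvature.  Only the
Hessian terms survive. *)
Lemma hessian_star_swap U (x y z : vfield U) :
  hessian D E x (star U y z) = hessian D E y (star U x z).
Proof.
pose N (w : vfield U) := D U w (global_on U E).
pose P (x y : vfield U) :=
  D U x (star U y z) + star U x (D U y z) - star U x (N (star U y z)).
have PB : P x y - P y x = star U (bracket x y) z.
  have starxy : star U x (star U y z) = star U y (star U x z).
    rewrite !(biflat_starA biflat).
    by rewrite (biflat_starC biflat x y).
  rewrite -(biflat_compatible' biflat) !biflat_nablaE !multBr starxy /P /N.
  by apply/vfield_eq => p f; rewrite !(vfieldBE, vfieldDE); ring.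
have DD' (u v : vfield U) : D' U u (D' U v z) =
    D U u (D U v z) - hessian D E u (star U v z) - N (P u v).
  rewrite !biflat_nablaE multBr !nablaBr nablaBl /hessian /N /P.
  rewrite nablaBl nablaDl.
  by apply/vfield_eq => p f; rewrite !(vfieldBE, vfieldDE); ring.
have flatD' := biflat_flat' biflat x y z.
rewrite !DD' biflat_nablaE -PB nablaBl in flatD'.
apply/eqP; rewrite eq_sym -subr_eq0 -[X in _ == X]flatD'.
rewrite -[X in X == _]addr0 -(biflat_flat biflat x y z) /N.
by apply/eqP/vfield_eq => p f; rewrite !(vfieldBE, vfieldDE); ring.
Qed.

Lemma star_unit_surj U (w : vfield U) :
  star U (global_on U e) (ast U (global_on U E) w) = w.
Proof.
apply: (bij_inj (biflat_mulE_iso biflat U)).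
by rewrite (biflat_mulE_star biflat) (biflat_ast1 biflat).
Qed.

Lemma biflat_hessian0 U (x y : vfield U) : hessian D E x y = 0.
Proof.
rewrite -(star_unit_surj y) hessian_star_swap.
rewrite hessianC; [|exact: biflat_torsion biflat|exact: biflat_flat biflat].
exact: (hessian_unit _ (biflat_torsion biflat) (biflat_astC biflat)
  (biflat_ast1 biflat) (biflat_euler biflat) (biflat_unit_parallel biflat)).
Qed.

End Structure.
End BiFlat.

Theorem lemma4p2 (R : realType) (n : nat) (M : complexManifold R n)
    (D D' : connection M) (ast star : multiplication M)
    (e E : vfield (opensT M)) :
  biflat_F_manifold D D' ast star e E ->
  saito_structure D ast e E /\
  forall (U : opens M) (x y : vfield U),
    D' U x y = D U x y - D U (star U x y) (global_on U E).
Proof.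
move=> biflat; split; last by move=> U x y; exact: (biflat_nablaE biflat).
case: (biflat) => *; split=> // U x y.
exact: (biflat_hessian0 biflat).
Qed.
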